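(* Let $n\ge 1$, let $Q\in\mathbb{R}^{n\times n}$ be symmetric and $\bm{c}\in\mathbb{R}^n$. Let $\hat r\in\mathbb{R}$ be such that the set $\mathcal{D}=\{\bm{u}\in\mathbb{R}^n : F([\bm{u},\hat r])\succeq 0\}$ has positive $n$-dimensional volume, and let $f_{\hat r}:\mathcal{D}\to\mathbb{R}$ be defined by $f_{\hat r}(\bm{u})=\inf\{t\in\mathbb{R} : F([\bm{u},\hat r]+t e_{n+1})\succeq 0\}$. Then the problem $$\min\ f_{\hat r}(\bm{u})\quad\text{subject to}\quad F([\bm{u},\hat r])\succeq 0$$ is a convex optimization problem; that is, its feasible set $\mathcal{D}$ is convex and $f_{\hat r}$ is a convex function on $\mathcal{D}$.
   Context: For $\bm{u}\in\mathbb{R}^n$ and $r\in\mathbb{R}$, $[\bm{u},r]\in\mathbb{R}^{n+1}$ denotes the vector whose first $n$ coordinates are those of $\bm{u}$ and whose last coordinate is $r$; $e_{n+1}$ is the $(n+1)$-th standard basis vector of $\mathbb{R}^{n+1}$, so $[\bm{u},\hat r]+te_{n+1}=[\bm{u},\hat r+t]$. Given a symmetric $Q\in\mathbb{R}^{n\times n}$ and $\bm{c}\in\mathbb{R}^n$, define the symmetric $(n+1)\times(n+1)$ matrix $$F([\bm{u},r])=\begin{bmatrix} r & -(\bm{c}+\bm{u})^T/2\\ -(\bm{c}+\bm{u})/2 & \mathrm{diag}(\bm{u})-Q\end{bmatrix},$$ where $\mathrm{diag}(\bm{u})$ is the diagonal matrix with diagonal $\bm{u}$. $M\succeq 0$ means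 that $M$ is positive semidefinite. *)

(* Defs.v *)
From HB Require Import structures.
From mathcomp Require Import all_boot all_order all_algebra.
From mathcomp Require Import all_classical all_reals all_analysis.

Set Implicit Arguments.
Unset Strict Implicit.
Unset Printing Implicit Defensive.

Import Order.TTheory GRing.Theory Num.Theory.
Import numFieldNormedType.Exports.

Local Open Scope classical_set_scope.
Local Open Scope ring_scope.

Lemma symmetricmxE (R : realType) (m : nat) (M : 'M[R]_m) :
  (M \is symmetricmx) = (M == M^T).
Proof. by rewrite is_hermitianmxE scale1r map_mx_id. Qed.

Definition psdmx (R : realType) (m : nat) (M : 'M[R]_m) : Prop :=
  M \is symmetricmx /\ forall x : 'cV[R]_m, 0 <= (x^T *m M *m x) 0 0.

Definition box (R : realType) (n : nat) (a b : 'cV[R]_n) : set 'cV[R]_n :=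
  [set x | forall i, a i 0 <= x i 0 <= b i 0].

(* n-dimensional Lebesgue (outer) measure: the infimum of the total volumes of
   the countable covers by closed boxes.  Every closed set is Lebesgue
   measurable, so on closed sets this is the n-dimensional volume. *)
Definition volume (R : realType) (n : nat) (A : set 'cV[R]_n) : \bar R :=
  ereal_inf [set (\sum_(0 <= k <oo) (\prod_i (ab.2 k i 0 - ab.1 k i 0))%:E)%E
            | ab in [set ab : (nat -> 'cV[R]_n) * (nat -> 'cV[R]_n) |
                     (forall k i, ab.1 k i 0 <= ab.2 k i 0) /\
                     A `<=` \bigcup_k box (ab.1 k) (ab.2 k)]].

Section Problem.
Variables (R : realType) (n : nat) (Q : 'M[R]_n) (c : 'cV[R]_n).

Definition vec_snoc (u : 'cV[R]_n) (r : R) : 'cV[R]_(n + 1) := col_mx u r%:M.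

Definition e_last : 'cV[R]_(n + 1) := delta_mx (rshift n ord0) 0.

Definition Fmx (x : 'cV[R]_(n + 1)) : 'M[R]_(1 + n) :=
  let u := usubmx x in
  let r := dsubmx x in
  block_mx r                          (- (2^-1 *: (c + u)^T))
           (- (2^-1 *: (c + u)))      (diag_mx u^T - Q).

Definition feasible (rhat : R) : set 'cV[R]_n :=
  [set u | psdmx (Fmx (vec_snoc u rhat))].

Definition shifts (rhat : R) (u : 'cV[R]_n) : set R :=
  [set t | psdmx (Fmx (vec_snoc u rhat + t *: e_last))].

(* [inf] is 0 on sets without an infimum; by [has_inf_shifts] below this does
   not occur on [feasible rhat]. *)
Definition f_ (rhat : R) (u : 'cV[R]_n) : R := inf (shifts rhat u).

Lemma vec_snocD u r t : vec_snoc u r + t *: e_last = vec_snoc u (r + t).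
Proof.
rewrite /vec_snoc; apply/matrixP => i j; rewrite ord1 {j} -[i]splitK.
case: (fintype.split i) => k /=; rewrite [LHS]mxE [X in _ + X]mxE.
  by rewrite !col_mxEu mxE eq_lrshift mulr0 addr0.
by rewrite !col_mxEd !mxE !ord1 !eqxx !mulr1n mulr1.
Qed.

Lemma has_inf_shifts rhat u : feasible rhat u -> has_inf (shifts rhat u).
Proof.
move=> Du; split.
  by exists 0; rewrite /shifts /= scale0r addr0.
exists (- rhat) => t; rewrite /shifts /= vec_snocD => -[_ /(_ (delta_mx 0 0))].
rewrite trmx_delta -rowE -colE [col _ _ _ _]mxE [row _ _ _ _]mxE.
have e0 : 0 = lshift n 0 :> 'I_(1 + n) by apply: val_inj.
by rewrite e0 /Fmx block_mxEul /vec_snoc col_mxKd mxE eqxx mulr1n -lerBlDl sub0r.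
Qed.

End Problem.

(* Main.v *)
(* [Fmx] is affine and positive semidefinite matrices form a convex cone, so the
   set of pairs [(u, t)] with [F([u, rhat + t])] positive semidefinite is convex:
   [feasible] is its slice at [t = 0] and [f_] its lower envelope in [t]. *)
Require Import Defs.
From mathcomp Require Import all_boot all_order all_algebra.
From mathcomp Require Import all_classical all_reals all_analysis.
From mathcomp Require Import ring.
Import Order.TTheory GRing.Theory Num.Theory.
Local Open Scope classical_set_scope.
Local Open Scope ring_scope.

(** For fixed [x] the quadratic form is linear in the matrix, so nonnegative weights keep it
    nonnegative; transposition is linear too. *)
Lemma psdmx_cone (R : realType) (m : nat) (A B : 'M[R]_m) (a b : R) :
  0 <= a -> 0 <= b -> psdmx A -> psdmx B -> psdmx (a *: A + b *: B).
Proof.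
move=> a0 b0 [+ pA] [+ pB]; rewrite /psdmx !symmetricmxE => /eqP sA /eqP sB.
split; first by rewrite linearD !linearZ /= -sA -sB.
move=> x; rewrite mulmxDr mulmxDl -!scalemxAr -!scalemxAl mxE.
by apply: addr_ge0; rewrite mxE mulr_ge0.
Qed.

(** The constant terms [c] and [Q] are reproduced exactly because the weights sum to 1. *)
Lemma Fmx_affine (R : realType) (n : nat) (Q : 'M[R]_n) (c : 'cV[R]_n)
    (x y : 'cV[R]_(n + 1)) (a b : R) :
  a + b = 1 -> Fmx Q c (a *: x + b *: y) = a *: Fmx Q c x + b *: Fmx Q c y.
Proof.
move=> ab; have -> : b = 1 - a by rewrite -ab addrAC subrr add0r.
rewrite /Fmx !scale_block_mx add_block_mx.
congr block_mx; apply/matrixP => i j; rewrite !mxE; last 1 first.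
  (* Entries of [diag_mx] carry a factor [*+ (i == j)], so diagonal and off-diagonal entries are
     treated apart. *)
  by case: eqP => _; rewrite ?mulr1n ?mulr0n; ring.
all: ring.
Qed.

Lemma vec_snoc_linear (R : realType) (n : nat) (u v : 'cV[R]_n) (a b r s : R) :
  vec_snoc (a *: u + b *: v) (a * r + b * s) =
  a *: vec_snoc u r + b *: vec_snoc v s.
Proof.
by rewrite /vec_snoc !scale_col_mx add_col_mx raddfD /= !scale_scalar_mx.
Qed.

(** Joint convexity in the vector and the shift: the common offset splits as
    [rhat = a * rhat + b * rhat]. *)
Lemma shifts_convex (R : realType) (n : nat) (Q : 'M[R]_n) (c : 'cV[R]_n)
    (rhat : R) (u v : 'cV[R]_n) (s t a b : R) :
  0 <= a -> 0 <= b -> a + b = 1 ->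
  shifts Q c rhat u s -> shifts Q c rhat v t ->
  shifts Q c rhat (a *: u + b *: v) (a * s + b * t).
Proof.
rewrite /shifts /= !vec_snocD => a0 b0 ab Fu Fv.
have -> : rhat + (a * s + b * t) = a * (rhat + s) + b * (rhat + t).
  by rewrite -[in LHS](mul1r rhat) -ab; ring.
by rewrite vec_snoc_linear Fmx_affine //; exact: psdmx_cone.
Qed.

Lemma feasible_shifts (R : realType) (n : nat) (Q : 'M[R]_n) (c : 'cV[R]_n)
    (rhat : R) (u : 'cV[R]_n) :
  feasible Q c rhat u <-> shifts Q c rhat u 0.
Proof. by rewrite /shifts /= vec_snocD addr0. Qed.

Lemma feasible_convex (R : realType) (n : nat) (Q : 'M[R]_n) (c : 'cV[R]_n)
    (rhat : R) (u v : 'cV[R]_n) (a b : R) :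
  0 <= a -> 0 <= b -> a + b = 1 ->
  feasible Q c rhat u -> feasible Q c rhat v ->
  feasible Q c rhat (a *: u + b *: v).
Proof.
move=> a0 b0 ab /feasible_shifts Du /feasible_shifts Dv; apply/feasible_shifts.
suff: shifts Q c rhat (a *: u + b *: v) (a * 0 + b * 0) by rewrite !mulr0 addr0.
by move: Du Dv; apply: shifts_convex.
Qed.

(** Attainment of the infima is avoided by taking shifts [s] and [t] within [e] of them;
    [a * s + b * t] is then an admissible shift at the combined point. *)
Lemma f_convex (R : realType) (n : nat) (Q : 'M[R]_n) (c : 'cV[R]_n)
    (rhat : R) (u v : 'cV[R]_n) (a b : R) :
  0 <= a -> 0 <= b -> a + b = 1 ->
  feasible Q c rhat u -> feasible Q c rhat v ->
  f_ Q c rhat (a *: u + b *: v) <= a * f_ Q c rhat u + b * f_ Q c rhat v.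
Proof.
move=> a0 b0 ab Du Dv; apply/ler_addgt0Pr => e e0.
have [s us lts] : exists2 s, shifts Q c rhat u s & s < f_ Q c rhat u + e.
  exact: (inf_adherent e0 (has_inf_shifts Du)).
have [t vt ltt] : exists2 t, shifts Q c rhat v t & t < f_ Q c rhat v + e.
  exact: (inf_adherent e0 (has_inf_shifts Dv)).
(* An infimum lies below each member only if the set is bounded below; feasibility of the combined
   point supplies this bound. *)
have /has_inf_shifts[_ lb] : feasible Q c rhat (a *: u + b *: v).
  exact: feasible_convex.
apply: (@le_trans _ _ (a * s + b * t)).
  by apply: (ge_inf lb); exact: shifts_convex.
move: lts ltt; move: (f_ Q c rhat u) (f_ Q c rhat v) => fu fv /ltW les /ltW let'.
have -> : a * fu + b * fv + e = a * (fu + e) + b * (fv + e).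
  by rewrite -[e in LHS]mul1r -ab; ring.
by rewrite lerD // ler_wpM2l.
Qed.

Theorem lemma2 (R : realType) (n : nat) (Q : 'M[R]_n) (c : 'cV[R]_n)
    (rhat : R) :
  (0 < n)%N ->
  Q \is symmetricmx ->
  (0 < volume (feasible Q c rhat))%E ->
  convex_set (feasible Q c rhat) /\
  convex_function (feasible Q c rhat) (f_ Q c rhat).
Proof.
(* [convex_set] and [convex_function] use a single weight [l] in the unit interval; the pair [a],
   [b] becomes [l], [1 - l]. *)
have weightsD (l : {i01 R}) : l%:num + (1 - l%:num) = 1 by rewrite addrC subrK.
move=> _ _ _; split.
  move=> u v l /set_mem Du /set_mem Dv; apply: mem_set.
  by apply: feasible_convex => //; rewrite subr_ge0 le1.
move=> l u v /set_mem Du /set_mem Dv.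
by apply: f_convex => //; rewrite subr_ge0 le1.
Qed.
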